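(* For each Mazur-type operator $B:\ell^1\to Y$ mapping onto a separable Banach space $Y$ there is a closed and complemented subspace $U\subseteq\ell^1$, isomorphic to $\ell^1$, such that the restriction $A:=B|_U:U\to Y$ is injective, the range of $A$ is dense in $Y$, and $U$ is a quasi-complement of the null-space $\mathcal{N}(B)$ in $\ell^1$. If $Y$ has a shrinking basis, then $A$ is weak*-to-weak continuous with respect to the predual $c_0$ of $\ell^1$.
   Context: A bounded linear operator $B:\ell^1\to Y$ into a separable Banach space $Y$ is of Mazur-type if there is a sequence $(\zeta^{(k)})_{k\in\mathbb{N}}$ of elements of the unit sphere of $Y$ which is dense in the unit sphere of $Y$ and satisfies $B\,x=\sum_{k=1}^\infty x_k\,\zeta^{(k)}$ for all $x=(x_1,x_2,\ldots)\in\ell^1$. $\mathcal{N}(B)$ denotes the null-space (kernel) of $B$. A closed subspace $U$ of a Banach space $X$ is complemented if there is a closed subspace $V\subseteq X$ with $U\cap V=\{0\}$ and $U+V=X$. A quasi-complement of a closed subspace $V\subseteq X$ is a closed subspace $U\subseteq X$ such that $U\cap V=\{0\}$ and $U+V$ is dense in $X$. Isomorphic means linearly homeomorphic. A Schauder basis of $Y$ is shrinking if the linear span of its sequence of biorthogonal (coordinate) functionals is norm-dense in the dual $Y^*$. Weak*-to-weak continuity of $A$ means continuity from $U$, equipped with the topology induced by the weak* topology of $\ell^1=(c_0)^*$, to $Y$ equipped with its weak topology.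
   Formalization: The Banach space Y is additionally assumed to be infinite-dimensional; for nonzero finite-dimensional Y (e.g. Y = R) the claim is false, since a subspace isomorphic to l^1 cannot be mapped injectively into Y. *)

(* Defs.v *)
From HB Require Import structures.
From mathcomp Require Import all_boot all_order all_algebra.
From mathcomp Require Import all_classical all_reals all_analysis.

Set Implicit Arguments.
Unset Strict Implicit.
Unset Printing Implicit Defensive.

Import Order.TTheory GRing.Theory Num.Theory.
Import numFieldNormedType.Exports.

Local Open Scope classical_set_scope.
Local Open Scope ring_scope.

(** MathComp-Analysis development; all spaces are real, over [R : realType]. *)

Section l1_space.
Context (R : realType).

(** Sequences are indexed from 0, so that [x k] stands for x_(k+1). *)
Definition l1_pred : {pred nat -> R} :=
  mem [set x : nat -> R | cvgn [normed series x]].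

Lemma l1_submod_closed : submod_closed l1_pred.
Proof.
have normed0 : [normed series (0 : nat -> R)] = series 0.
  by rewrite funeqE => n; apply: eq_bigr => i _ /=; rewrite normr0.
split.
  rewrite inE /= normed0.
  suff -> : series (0 : nat -> R) = cst 0 by exact: is_cvg_cst.
  by rewrite funeqE => n; rewrite /series /= big1.
move=> a x y; rewrite !inE /= => cx cy.
apply: (@series_le_cvg _ _ (fun k => `|a| * `|x k| + `|y k|)).
- by move=> n /=.
- by move=> n /=; rewrite addr_ge0 ?mulr_ge0.
- by move=> n /=; rewrite (le_trans (ler_normD _ _))// lerD2r normrM.
exact: (is_cvg_seriesD (is_cvg_seriesZ (k := `|a|) cx) cy).
Qed.

HB.instance Definition _ :=
  GRing.isSubmodClosed.Build R (nat -> R) l1_pred l1_submod_closed.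

Record l1 := L1 { l1_val :> nat -> R ; l1_valP : l1_val \in l1_pred }.

HB.instance Definition _ := [isSub for l1_val].
HB.instance Definition _ := [Choice of l1 by <:].
HB.instance Definition _ := [SubChoice_isSubLmodule of l1 by <:].

Definition l1_norm (x : l1) : R := limn [normed series x].

Lemma l1_cvg (x : l1) : cvgn [normed series x].
Proof. by have := l1_valP x; rewrite inE. Qed.

Lemma l1_normD (x y : l1) : l1_norm (x + y) <= l1_norm x + l1_norm y.
Proof.
rewrite -lim_seriesD; [|exact: l1_cvg|exact: l1_cvg].
apply: ler_lim; first exact: l1_cvg.
  by apply: is_cvg_seriesD; exact: l1_cvg.
by near=> n; apply: ler_sum => i _; exact: ler_normD.
Unshelve. all: by end_near. Qed.

Lemma l1_normZ (a : R) (x : l1) : l1_norm (a *: x) = `|a| * l1_norm x.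
Proof.
rewrite /l1_norm -[RHS]lim_seriesZ; last exact: l1_cvg.
by congr (limn (series _)); rewrite funeqE => k; exact: normrM.
Qed.

Lemma l1_norm_eq0 (x : l1) : l1_norm x = 0 -> x = 0.
Proof.
move=> x0; apply/val_inj; rewrite funeqE => k /=.
apply/eqP; rewrite -normr_le0 -x0.
have nd : nondecreasing_seq [normed series x].
  by apply: nondecreasing_series => n _ _ /=.
apply: le_trans (nondecreasing_cvgn_le nd (l1_cvg (x := x)) k.+1).
by rewrite [leRHS]seriesSr lerDr; apply: sumr_ge0 => i _ /=.
Qed.

HB.instance Definition _ :=
  Lmodule_isNormed.Build R l1 l1_normD l1_normZ l1_norm_eq0.

End l1_space.

Section normed_spaces.
Context (R : realType).

Definition separable (V : normedModType R) : Prop :=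
  exists2 D : set V, countable D & dense D.

Definition infinite_dimensional (V : normedModType R) : Prop :=
  ~ exists n (b : 'I_n -> V), forall v, exists a : 'I_n -> R,
      v = \sum_(i < n) a i *: b i.

Definition unit_sphere (V : normedModType R) : set V := [set y | `|y| = 1].

Definition null_space (V W : normedModType R) (T : {linear V -> W}) : set V :=
  T @^-1` [set 0].

Definition closed_subspace (V : normedModType R) (U : set V) : Prop :=
  submod_closed [in U] /\ closed U.

Definition sum_set (V : normedModType R) (U W : set V) : set V :=
  [set u + w | u in U & w in W].

Definition complemented (V : normedModType R) (U : set V) : Prop :=
  exists W : set V,
    [/\ closed_subspace W, U `&` W = [set 0] & sum_set U W = setT].

Definition quasi_complement (V : normedModType R) (W U : set V) : Prop :=
  [/\ closed_subspace U, U `&` W = [set 0] & dense (sum_set U W)].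

(** [T] is a linear homeomorphism of [W] onto [U], [U] carrying the subspace
    topology of [V], and [S] is its inverse. *)
Definition isomorphic (V W : normedModType R) (U : set V) : Prop :=
  exists (T : {linear W -> V}) (S : V -> W),
    [/\ continuous T, range T = U, cancel T S & {within U, continuous S}].

Definition dual (V : normedModType R) : Type :=
  {f : {linear V -> R^o} | continuous f}.

Definition dual_fun (V : normedModType R) (f : dual V) : V -> R := sval f.

(** The coarsest topology making every element of the dual continuous: the
    initial topology for the evaluation map into the pointwise topology. *)
Definition weak_topology (V : normedModType R) : topologicalType :=
  initial_topology
    (fun v : V => (fun f => dual_fun f v) : {ptws dual V -> R}).

Definition c0 : Type := {c : nat -> R | c @ \oo --> (0 : R)}.

Definition c0_pairing (x : l1 R) (c : c0) : R :=
  limn (series (fun k => x k * sval c k)).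

(** The weak* topology of [l1] as the dual of [c0] through [c0_pairing], i.e.
    pointwise convergence on [c0]. *)
Definition weak_star_topology : topologicalType :=
  initial_topology (c0_pairing : l1 R -> {ptws c0 -> R}).

Definition continuous_on (S T : topologicalType) (U : set S) (f : S -> T) :=
  {within U, continuous f}.

(** The topologies are passed explicitly, as [{within U, continuous A}] at type
    [l1 R] would refer to the norm topology on [U]. *)
Definition weak_star_to_weak_continuous (V : normedModType R) (U : set (l1 R))
    (A : l1 R -> V) : Prop :=
  @continuous_on weak_star_topology (weak_topology V) U A.

(** Extended-real valued, so that it is +oo on unbounded functionals. *)
Definition dual_norm (V : normedModType R) (f : V -> R) : \bar R :=
  ereal_sup [set `|f v|%:E | v in [set v | `|v| <= 1]].

End normed_spaces.

Arguments unit_sphere {R} V.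

Section bases.
Context (R : realType) (Y : normedModType R).

Definition expansion (e : nat -> Y) (y : Y) (a : nat -> R) : Prop :=
  series (fun n => a n *: e n) @ \oo --> y.

Definition schauder_basis (e : nat -> Y) : Prop :=
  forall y, exists! a : nat -> R, expansion e y a.

Definition coordinate (e : nat -> Y) (n : nat) (y : Y) : R :=
  get (expansion e y) n.

(** On a Banach space the coordinate functionals of a Schauder basis are
    automatically bounded, hence elements of the dual. *)
Definition shrinking_basis (e : nat -> Y) : Prop :=
  schauder_basis e /\
  forall (f : dual Y) (eps : R), 0 < eps -> exists N (c : 'I_N -> R),
    (dual_norm (fun y =>
       (dual_fun f y - \sum_(n < N) c n * coordinate e n y)%R) < eps%:E)%E.

End bases.

Definition mazur_type (R : realType) (Y : completeNormedModType R)
    (B : {linear l1 R -> Y}) : Prop :=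
  bounded_near B (nbhs (0 : l1 R)) /\
  exists zeta : nat -> Y,
    [/\ range zeta `<=` unit_sphere Y,
        unit_sphere Y `<=` closure (range zeta) &
        forall x : l1 R, series (fun k => x k *: zeta k) @ \oo --> B x].

(* Main.v *)
Require Import Defs.
From HB Require Import structures.
From mathcomp Require Import all_boot all_order all_algebra.
From mathcomp Require Import all_classical all_reals all_analysis.
From mathcomp Require Import ring lra.

Set Implicit Arguments.
Unset Strict Implicit.
Unset Printing Implicit Defensive.

Import Order.TTheory GRing.Theory Num.Theory.
Import numFieldNormedType.Exports.

Local Open Scope classical_set_scope.
Local Open Scope ring_scope.

(** Write [B x] as the sum of the [x k *: zeta k], with [zeta] dense in the unit
    sphere. The subspace [U] consists of the sequences supported on a set
    of indices [k 0, k 1, ...]. Such a coordinate subspace is an isometric copy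
    of l1 and the range of a norm-one projection, so it is closed and
    complemented, and everything depends on choosing the [k n] so that the
    vectors [zeta (k n)] behave like a basis of [Y].

    Gram-Schmidt, with functionals supplied by the Hahn-Banach theorem, gives
    unit vectors [y n] with linearly dense span and bounded functionals [f n]
    biorthogonal to them ([biorthogonal_sequence]). Each [y n] is then replaced
    by some [zeta (k n)] at distance at most [2^-(n+2) / b n], where [b n]
    bounds the norm of [f n]. This is close enough for the [zeta (k n)] to keep
    the two properties that matter: a series of them with coefficients in l1
    vanishes only if all coefficients do ([perturbed_independent]), so [B] is
    injective on [U]; and finite combinations of them approximate every
    vector of [Y] with relative error at most 3/4 ([perturbed_approximates]),
    hence are dense ([dense_of_relative_approximation]), so [B] maps [U] onto
    a dense subspace.

    The quasi-complement property is the image of these two facts in l1.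
    Injectivity says that [U] meets the null space trivially. For density of the
    sum, approximate [B x] by [B u] with [u] in [U] and lift the small difference
    to a small vector [w] of l1, which is possible with norm at most twice that
    of the difference ([mazur_lift]); then [x - u - w] lies in the null space.

    A functional [h] on [Y] becomes on [U] the pairing with the sequence that has
    the value [h (zeta (k n))] at [k n] and vanishes elsewhere. Weak*-to-weak
    continuity on [U] therefore amounts to [zeta (k n)] tending weakly to 0, and
    it suffices that [y n] does. When [Y] has a shrinking basis, countably many
    bounded functionals have dense span in the dual ([shrinking_weak_null]).
    The Gram-Schmidt process can absorb those functionals into the span of the
    [f n] along with the vectors, and then each of them vanishes at [y n] for
    large [n]. *)

(** * Bounded functionals and the Hahn-Banach theorem *)

Section sublinear.
Context (R : realType) (V : lmodType R).
Implicit Types (q p : V -> R) (u v y : V).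

Definition sublinear q :=
  (forall u v, q (u + v) <= q u + q v) /\
  (forall (a : R) v, 0 < a -> q (a *: v) <= a * q v).

Lemma sublinear_ge0 q v : sublinear q -> 0 <= q v + q (- v).
Proof.
move=> [qD _]; have := qD 0 0; have := qD v (- v).
by rewrite subrr addr0; lra.
Qed.

Lemma sublinearZ q (t : R) v : sublinear q -> 0 <= t -> t * q v <= q (t *: v).
Proof.
move=> sq; rewrite le_eqVlt => /predU1P[<-|t0].
  by have := sublinear_ge0 0 sq; rewrite oppr0 scale0r; lra.
have := sq.2 t^-1 (t *: v); rewrite invr_gt0 => /(_ t0).
by rewrite scalerA mulVf ?gt_eqF// scale1r -ler_pdivlMl.
Qed.

(** Lowering [q] as far as possible along the ray of [y]. Tilting serves twice:
    a minimal sublinear functional equals its tilts, which makes it additive,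
    and tilting the norm along [y] forces a linear functional below it to attain
    [`|y|] at [y]. *)
Definition tilt q y v : R :=
  inf [set q (v + t *: y) - t * q y | t in [set t : R | 0 <= t]].

Lemma tilt_lbound q y v : sublinear q ->
  lbound [set q (v + t *: y) - t * q y | t in [set t : R | 0 <= t]] (- q (- v)).
Proof.
move=> sq _ [t /= t0 <-].
have := sublinearZ y sq t0; have := sq.1 (v + t *: y) (- v).
by rewrite addrAC subrr add0r; lra.
Qed.

Lemma tilt_le q y v (t : R) : sublinear q -> 0 <= t ->
  tilt q y v <= q (v + t *: y) - t * q y.
Proof.
move=> sq t0; apply: ge_inf; last by exists t.
by exists (- q (- v)); exact: tilt_lbound.
Qed.

Lemma tilt_ge q y v (c : R) :
  (forall t, 0 <= t -> c <= q (v + t *: y) - t * q y) -> c <= tilt q y v.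
Proof.
move=> cq; apply: lb_le_inf; first by exists (q (v + 0 *: y) - 0 * q y); exists 0 => /=.
by move=> _ [t /= t0 <-]; exact: cq.
Qed.

Lemma sublinear_tilt q y : sublinear q -> sublinear (tilt q y).
Proof.
move=> sq; split=> [u v|a v a0].
  rewrite -lerBlDr; apply: tilt_ge => s s0.
  rewrite lerBlDr -lerBlDl; apply: tilt_ge => t t0.
  have := tilt_le y (u + v) sq (addr_ge0 s0 t0).
  have := sq.1 (u + s *: y) (v + t *: y).
  by rewrite scalerDl addrACA; lra.
rewrite -ler_pdivrMl//; apply: tilt_ge => t t0; rewrite ler_pdivrMl//.
have := tilt_le y (a *: v) sq (mulr_ge0 (ltW a0) t0).
by have := sq.2 a (v + t *: y) a0; rewrite scalerDr scalerA; lra.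
Qed.

Lemma tilt_le_id q y v : sublinear q -> tilt q y v <= q v.
Proof. by move=> sq; have := tilt_le y v sq (lexx 0); rewrite scale0r addr0; lra. Qed.

(** A chain of sublinear functionals has its pointwise infimum as a sublinear
    lower bound: subadditivity compares two members at the smaller of them. *)
Lemma sublinear_chain (A : set (V -> R)) :
  A !=set0 -> (forall q, A q -> sublinear q) ->
  (forall q q', A q -> A q' -> (forall v, q v <= q' v) \/ (forall v, q' v <= q v)) ->
  exists2 m : V -> R, sublinear m & forall q v, A q -> m v <= q v.
Proof.
move=> [q0 Aq0] sA totA.
have lbA v : has_lbound [set q v | q in A].
  exists (- q0 (- v)) => _ [q Aq <-].
  have [le_q|le_q] := totA _ _ Aq Aq0.
    by have := sublinear_ge0 v (sA _ Aq); have := le_q (- v); lra.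
  by have := sublinear_ge0 v (sA _ Aq0); have := le_q v; lra.
pose m v := inf [set q v | q in A].
have mle q v : A q -> m v <= q v.
  by move=> Aq; apply: ge_inf; [exact: lbA|exists q].
have m_ge v c : (forall q, A q -> c <= q v) -> c <= m v.
  move=> cq; apply: lb_le_inf; first by exists (q0 v); exists q0.
  by move=> _ [q Aq <-]; exact: cq.
exists m => //; split=> [u v|a v a0].
  rewrite -lerBlDr; apply: (m_ge u) => q Aq; rewrite lerBlDr -lerBlDl.
  apply: (m_ge v) => q' Aq'; rewrite lerBlDl.
  have [le_q|le_q] := totA _ _ Aq Aq'.
    have := mle _ (u + v) Aq; have := (sA _ Aq).1 u v; have := le_q v; lra.
  have := mle _ (u + v) Aq'; have := (sA _ Aq').1 u v; have := le_q u; lra.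
rewrite -ler_pdivrMl//; apply: (m_ge v) => q Aq; rewrite ler_pdivrMl//.
exact: le_trans (mle _ _ Aq) ((sA _ Aq).2 _ _ a0).
Qed.

(** Hahn-Banach in the form: a minimal sublinear functional below [p] is
    linear. Minimality makes it equal to all its tilts, which forces
    [q v + q y <= q (v + y)]. *)
Lemma sublinear_dominates_linear p : sublinear p ->
  exists2 f : V -> R, (forall (a : R) u v, f (a *: u + v) = a * f u + f v) &
    forall v, f v <= p v.
Proof.
move=> sp.
pose T := {q : V -> R | sublinear q /\ forall v, q v <= p v}.
pose ge (s t : T) := `[< forall v, sval t v <= sval s v >].
have [||||[q [sq qp]] qmin] := @Zorn T ge.
- by move=> s; apply/asboolP => v.
- move=> r s t /asboolP rs /asboolP st; apply/asboolP => v.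
  exact: le_trans (st v) (rs v).
- move=> [s Ps] [t Pt] /asboolP/= st /asboolP/= ts; apply: eq_exist.
  by apply/funext => v; apply/le_anti/andP.
- move=> A totA.
  have [[t At]|A0] := pselect (A !=set0); last first.
    by exists (exist _ p (conj sp (fun v => lexx _))) => s As; case: A0; exists s.
  have [|||m sm mle] := @sublinear_chain [set sval s | s in A].
  + by exists (sval t); exists t.
  + by move=> _ [s As <-]; exact: (svalP s).1.
  + move=> _ _ [r Ar <-] [s As <-].
    by have [/asboolP ?|/asboolP ?] := totA _ _ Ar As; [right|left].
  have mp v : m v <= p v.
    by apply: le_trans (mle _ v _) ((svalP t).2 v); exists t.
  exists (exist _ m (conj sm mp)) => s As; apply/asboolP => v /=.
  by apply: mle; exists s.
have tiltE y : tilt q y = q.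
  have tp v : tilt q y v <= p v by exact: le_trans (tilt_le_id y v sq) (qp v).
  pose t : T := exist _ (tilt q y) (conj (sublinear_tilt y sq) tp).
  suff /(congr1 sval) : t = exist _ q (conj sq qp) by [].
  by apply: qmin; apply/asboolP => v; exact: tilt_le_id.
have qD u v : q (u + v) = q u + q v.
  apply/le_anti/andP; split; first exact: sq.1.
  by have := tilt_le v u sq (@ler01 R); rewrite tiltE scale1r; lra.
have q0 : q 0 = 0 by have := qD 0 0; rewrite addr0; lra.
have qN v : q (- v) = - q v by have := qD v (- v); rewrite subrr q0; lra.
have qZp a v : 0 <= a -> q (a *: v) = a * q v.
  rewrite le_eqVlt => /predU1P[<-|a0]; first by rewrite scale0r mul0r.
  by apply/le_anti/andP; split; [exact: sq.2|exact: sublinearZ sq (ltW a0)].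
exists q => // a u v; rewrite qD; congr (_ + _).
have [a0|a0] := leP 0 a; first exact: qZp.
have := qZp (- a) u; rewrite scaleNr qN oppr_ge0 => /(_ (ltW a0)).
by rewrite mulNr => /oppr_inj.
Qed.

End sublinear.

Section bounded_functionals.
Context (R : realType) (V : normedModType R).
Implicit Types (f g : V -> R) (v : V).

Definition bounded_functional f :=
  (forall (a : R) u v, f (a *: u + v) = a * f u + f v) /\
  exists b, forall v, `|f v| <= b * `|v|.

Lemma bfun0 f : bounded_functional f -> f 0 = 0.
Proof. by move=> [fL _]; have := fL 1 0 0; rewrite scale1r addr0; lra. Qed.

Lemma bfunD f u v : bounded_functional f -> f (u + v) = f u + f v.
Proof. by move=> [fL _]; have := fL 1 u v; rewrite scale1r mul1r. Qed.

Lemma bfunZ f (a : R) v : bounded_functional f -> f (a *: v) = a * f v.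
Proof.
by move=> bf; have := bf.1 a v 0; rewrite (bfun0 bf) !addr0.
Qed.

Lemma bfunB f u v : bounded_functional f -> f (u - v) = f u - f v.
Proof. by move=> bf; rewrite bfunD// -scaleN1r bfunZ// mulN1r. Qed.

Lemma bfun_sum f n (F : 'I_n -> V) : bounded_functional f ->
  f (\sum_(i < n) F i) = \sum_(i < n) f (F i).
Proof.
move=> bf; elim: n F => [|n IH] F; first by rewrite !big_ord0 bfun0.
by rewrite !big_ord_recr/= bfunD// IH.
Qed.

Lemma bfun_bound f : bounded_functional f ->
  exists2 b, 1 <= b & forall v, `|f v| <= b * `|v|.
Proof.
move=> [_ [b fb]]; exists (Num.max 1 b) => [|v]; first by rewrite le_max lexx.
by apply: le_trans (fb v) _; rewrite ler_wpM2r// le_max lexx orbT.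
Qed.

Lemma bfun_lin f g (a : R) : bounded_functional f -> bounded_functional g ->
  bounded_functional (fun v => a * f v + g v).
Proof.
move=> [fL [b fb]] [gL [c gc]]; split=> [t u v|].
  by rewrite fL gL; ring.
exists (`|a| * b + c) => v; apply: le_trans (ler_normD _ _) _.
rewrite mulrDl lerD// normrM -mulrA.
by rewrite ler_wpM2l.
Qed.

Lemma bfun_cst0 : bounded_functional (fun=> 0).
Proof.
split=> [*|]; first by rewrite mulr0 addr0.
by exists 0 => v; rewrite normr0 mul0r.
Qed.

Lemma bfun_scale f (a : R) : bounded_functional f ->
  bounded_functional (fun v => a * f v).
Proof.
move=> bf; have := bfun_lin a bf bfun_cst0.
by congr bounded_functional; apply/funext => v; rewrite addr0.
Qed.

Lemma bfun_comb n (c : 'I_n -> R) (F : 'I_n -> V -> R) :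
  (forall i, bounded_functional (F i)) ->
  bounded_functional (fun v => \sum_(i < n) c i * F i v).
Proof.
elim: n c F => [|n IH] c F bF.
  have := bfun_cst0; congr bounded_functional.
  by apply/funext => v; rewrite big_ord0.
have := bfun_lin (c ord_max) (bF ord_max)
  (IH (fun i => c (widen_ord (leqnSn n) i)) _ (fun i => bF (widen_ord (leqnSn n) i))).
by congr bounded_functional; apply/funext => v; rewrite big_ord_recr/= addrC.
Qed.

(** Take a linear functional below the norm tilted along [v]: the tilt has
    value at most [- `|v|] at [- v], which forces [`|v| <= f v]. *)
Lemma separating_functional v : v != 0 ->
  exists2 f, bounded_functional f & f v != 0.
Proof.
move=> v0.
have sn : sublinear (fun u : V => `|u|).
  split=> [u w|a u a0]; first exact: ler_normD.
  by rewrite normrZ gtr0_norm.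
have [f fL fle] := sublinear_dominates_linear (sublinear_tilt v sn).
have fn u : f u <= `|u| by exact: le_trans (fle u) (tilt_le_id v u sn).
have f0 : f 0 = 0 by have := fL 1 0 0; rewrite scale1r addr0; lra.
have fN u : f (- u) = - f u.
  by have := fL (-1) u 0; rewrite scaleN1r addr0 f0; lra.
exists f.
  split=> //; exists 1 => u; rewrite mul1r ler_norml fn andbT.
  by rewrite -lerN2 opprK -fN (le_trans (fn _))// normrN.
have := le_trans (fle (- v)) (tilt_le v (- v) sn ler01).
rewrite scale1r addNr normr0 fN mul1r sub0r lerN2 => vf.
by rewrite gt_eqF// (lt_le_trans _ vf)// normr_gt0.
Qed.

End bounded_functionals.

(** * Biorthogonal systems *)

Lemma course_of_values_choice (T : Type) (P : seq T -> T -> Prop) :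
  (forall s, exists x, P s x) -> exists p : nat -> T, forall n, P (mkseq p n) (p n).
Proof.
move=> /choice[h Ph].
pose L := fix L n := if n is m.+1 then rcons (L m) (h (L m)) else [::].
exists (fun n => h (L n)) => n.
suff -> : mkseq (fun n => h (L n)) n = L n by exact: Ph.
by elim: n => // n IH; rewrite mkseqS IH.
Qed.

Section biorthogonal_systems.
Context (R : realType) (Y : normedModType R).
Hypothesis Yinf : infinite_dimensional Y.
Local Notation pair := (Y * (Y -> R))%type.
Implicit Types (s : nat -> pair) (n : nat) (x y v : Y) (f g : Y -> R).

(** A finite system is given by the values below [n] of a sequence of pairs
    (vector, functional). *)
Definition biorthogonal n s :=
  (forall i, (i < n)%N -> bounded_functional (s i).2) /\
  forall i j, (i < n)%N -> (j < n)%N -> (s i).2 (s j).1 = (i == j)%:R.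

Definition extends n s (p : pair) :=
  [/\ `|p.1| = 1, bounded_functional p.2, p.2 p.1 = 1,
      forall i, (i < n)%N -> (s i).2 p.1 = 0 &
      forall i, (i < n)%N -> p.2 (s i).1 = 0].

Definition proj_vector n s x := \sum_(i < n) (s i).2 x *: (s i).1.

Definition proj_functional n s g v := \sum_(i < n) g (s i).1 * (s i).2 v.

Lemma biorthogonal_proj_vector n s x j : biorthogonal n s -> (j < n)%N ->
  (s j).2 (proj_vector n s x) = (s j).2 x.
Proof.
move=> [bs bio] jn; rewrite /proj_vector bfun_sum; last exact: bs.
rewrite (bigD1 (Ordinal jn))//= big1 => [|i ij].
  by rewrite addr0 bfunZ ?bio ?eqxx ?mulr1//; exact: bs.
rewrite bfunZ ?bio//; last exact: bs.
by rewrite (_ : (j == i) = false) ?mulr0// eq_sym; exact: negbTE ij.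
Qed.

Lemma biorthogonal_proj_functional n s g j : biorthogonal n s -> (j < n)%N ->
  proj_functional n s g (s j).1 = g (s j).1.
Proof.
move=> [bs bio] jn; rewrite /proj_functional.
rewrite (bigD1 (Ordinal jn))//= big1 => [|i ij].
  by rewrite addr0 bio ?eqxx ?mulr1.
by rewrite bio// (_ : (i == j :> nat) = false) ?mulr0//; exact: negbTE ij.
Qed.

Lemma bfun_residue n s g : biorthogonal n s -> bounded_functional g ->
  bounded_functional (fun v => g v - proj_functional n s g v).
Proof.
move=> [bs _] bg.
have bp := bfun_comb (fun i : 'I_n => g (s i).1) (fun i : 'I_n => bs i (ltn_ord i)).
have := bfun_lin (-1) bp bg.
by congr bounded_functional; apply/funext => v; rewrite mulN1r addrC.
Qed.

(** The Gram-Schmidt step: subtracting from [g] its projection makes it vanish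
    on the system without changing its value at [y], because the functionals of
    the system vanish at [y]. *)
Lemma extends_residue n s y g : biorthogonal n s -> bounded_functional g ->
  (forall i, (i < n)%N -> (s i).2 y = 0) -> g y != 0 ->
  extends n s (`|y|^-1 *: y,
    fun v => `|y| / g y * (g v - proj_functional n s g v)).
Proof.
move=> bio bg sy gy.
have y0 : `|y| != 0.
  by rewrite normr_eq0; apply: contra_neq gy => ->; rewrite bfun0.
have br := bfun_residue bio bg.
have pgy : proj_functional n s g y = 0.
  by apply: big1 => i _; rewrite sy ?mulr0.
split => /=.
- by rewrite normrZ normfV normr_id mulVf.
- exact: bfun_scale.
- have /= -> := bfunZ `|y|^-1 y br.
  by rewrite pgy subr0 mulrACA divff// mulVf// mulr1.
- by move=> i lin; rewrite bfunZ ?sy ?mulr0//; exact: bio.1.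
- by move=> i lin; rewrite biorthogonal_proj_functional// subrr mulr0.
Qed.

Lemma residue_vector n s x i : biorthogonal n s -> (i < n)%N ->
  (s i).2 (x - proj_vector n s x) = 0.
Proof.
move=> bio lin; rewrite bfunB; last exact: bio.1.
by rewrite biorthogonal_proj_vector// subrr.
Qed.

(** If [x] already lies in the span of the system, the new vector is the residue
    of any vector outside it; one exists in infinite dimension. Thus every
    step adds exactly one pair. *)
Lemma extend_vector n s x : biorthogonal n s ->
  exists p, extends n s p /\ exists c, x - proj_vector n s x = c *: p.1.
Proof.
move=> bio.
have [z [z0 zx]] : exists z, z - proj_vector n s z != 0 /\
    (x - proj_vector n s x != 0 -> z = x).
  have [xs|xs] := eqVneq (x - proj_vector n s x) 0; last by exists x.
  apply: contrapT => /forallNP Nz; apply: Yinf.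
  exists n, (fun i => (s i).1) => v; exists (fun i => (s i).2 v).
  apply/eqP; rewrite -subr_eq0; apply: contrapT => /negP v0.
  by apply: (Nz v); split.
have [g bg gz] := separating_functional z0.
have sz i : (i < n)%N -> (s i).2 (z - proj_vector n s z) = 0.
  exact: residue_vector.
have := extends_residue bio bg sz gz; set p := (_, _) => sp.
exists p; split=> //.
have [->|xs] := eqVneq (x - proj_vector n s x) 0.
  by exists 0; rewrite scale0r.
exists `|x - proj_vector n s x|.
by rewrite -(zx xs) /= scalerA divff ?scale1r// normr_eq0.
Qed.

(** Dually, if the residue of [g] does not vanish at [v], then it takes the same
    value at [v] and at the residue [y] of [v], which makes [y] a new vector. *)
Lemma extend_functional n s g : biorthogonal n s -> bounded_functional g ->
  exists p, extends n s p /\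
    exists c, forall v, g v - proj_functional n s g v = c * p.2 v.
Proof.
move=> bio bg.
have [/existsNP[v /eqP gv]|g0] :=
    pselect (~ forall v, g v - proj_functional n s g v = 0); last first.
  have [p [sp _]] := extend_vector 0 bio.
  exists p; split=> //; exists 0 => v; rewrite mul0r.
  by move/contrapT : g0.
have br := bfun_residue bio bg.
pose y := v - proj_vector n s v.
have sy i : (i < n)%N -> (s i).2 y = 0 by exact: residue_vector.
have gy : g y = g v - proj_functional n s g v.
  rewrite bfunB// bfun_sum//; congr (_ - _).
  by apply: eq_bigr => i _; rewrite bfunZ// mulrC.
have y0 : g y != 0 by rewrite gy.
have := extends_residue bio bg sy y0; set p := (_, _) => sp.
exists p; split=> //.
exists (g y / `|y|) => u /=; rewrite mulrA mulrA divfK ?divff ?mul1r//.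
by rewrite normr_eq0; apply: contra_neq y0 => ->; rewrite bfun0.
Qed.

Lemma biorthogonalS n s : biorthogonal n s -> extends n s (s n) ->
  biorthogonal n.+1 s.
Proof.
move=> [bs bio] [_ bn nn sn ns]; split=> [i|i j].
  by rewrite ltnS leq_eqVlt => /predU1P[->//|/bs].
rewrite !ltnS leq_eqVlt => /predU1P[->|lin].
  rewrite leq_eqVlt => /predU1P[->|ljn]; first by rewrite eqxx.
  by rewrite ns// (gtn_eqF ljn).
rewrite leq_eqVlt => /predU1P[->|ljn]; last exact: bio.
by rewrite sn// (ltn_eqF lin).
Qed.

(** Even steps absorb the vectors [x j] into the span, odd steps absorb the
    functionals [g j] into the span of the biorthogonal functionals, which
    makes [g j] vanish on all later vectors. *)
Lemma biorthogonal_sequence (x : nat -> Y) (g : nat -> Y -> R) :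
  (forall j, bounded_functional (g j)) ->
  exists (y : nat -> Y) (f : nat -> Y -> R),
    [/\ forall n, `|y n| = 1,
        forall n, bounded_functional (f n),
        forall n m, f n (y m) = (n == m)%:R,
        forall j, exists n, x j = \sum_(i < n) f i (x j) *: y i &
        forall j, exists n, forall m, (n <= m)%N -> g j (y m) = 0].
Proof.
move=> bg.
(* [d] is only a default value for reading lists as sequences. *)
pose d : pair := (0, fun=> 0).
pose P (l : seq pair) (p : pair) := let n := size l in let s := nth d l in
  biorthogonal n s -> extends n s p /\
    if odd n then exists c, forall v,
        g n./2 v - proj_functional n s (g n./2) v = c * p.2 v
    else exists c, x n./2 - proj_vector n s (x n./2) = c *: p.1.
have [|s Ps] := @course_of_values_choice _ P.
  move=> l; rewrite /P.
  have [bio|nbio] := pselect (biorthogonal (size l) (nth d l)); last by exists d.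
  case: (odd (size l)).
    by have [p ?] := extend_functional bio (bg (size l)./2); exists p.
  by have [p ?] := extend_vector (x (size l)./2) bio; exists p.
have {Ps} step n : biorthogonal n s -> extends n s (s n) /\
    if odd n then exists c, forall v,
        g n./2 v - proj_functional n s (g n./2) v = c * (s n).2 v
    else exists c, x n./2 - proj_vector n s (x n./2) = c *: (s n).1.
  have nthE i : (i < n)%N -> nth d (mkseq s n) i = s i by exact: nth_mkseq.
  move=> [bs bio]; have := Ps n; rewrite /P size_mkseq => H.
  have -> : proj_vector n s = proj_vector n (nth d (mkseq s n)).
    by apply/funext => v; apply: eq_bigr => i _; rewrite nthE.
  have -> : proj_functional n s = proj_functional n (nth d (mkseq s n)).
    by apply/funext => h; apply/funext => v; apply: eq_bigr => i _; rewrite nthE.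
  have [|[e1 e2 e3 e4 e5] ?] := H.
    split=> [i lin|i j lin ljn]; first by rewrite nthE//; exact: bs.
    by rewrite !nthE//; exact: bio.
  split=> //; split=> // i lin; [have := e4 i lin|have := e5 i lin];
    by rewrite nthE.
have bio n : biorthogonal n s.
  elim: n => [|n IH]; first by split.
  by apply: biorthogonalS => //; have [] := step _ IH.
have ext n : extends n s (s n) by have [] := step _ (bio n).
exists (fun n => (s n).1), (fun n => (s n).2); split.
- by move=> n; have [] := ext n.
- by move=> n; have [] := ext n.
- move=> n m; have [_ H] := bio (maxn n m).+1.
  by apply: H; rewrite ltnS ?leq_maxl ?leq_maxr.
- move=> j; have [_] := step _ (bio j.*2).
  rewrite odd_double doubleK => -[c xc]; exists j.*2.+1.
  have [_ b e se _] := ext j.*2.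
  rewrite big_ord_recr/=.
  suff -> : (s j.*2).2 (x j) = c by rewrite -xc /proj_vector addrC subrK.
  have : (s j.*2).2 (x j - proj_vector j.*2 s (x j)) = c.
    by rewrite xc bfunZ// e mulr1.
  rewrite bfunB// bfun_sum// big1 ?subr0// => i _.
  by rewrite bfunZ//; have [_ _ _ _ ->] := ext j.*2; rewrite ?mulr0.
- move=> j; have [_] := step _ (bio j.*2.+1).
  rewrite /= odd_double/= uphalf_double => -[c gc]; exists j.*2.+2 => m jm.
  have [_ H] := bio m.+1.
  have /eqP := gc (s m).1; rewrite H ?ltnS// ?(ltnW jm)//.
  rewrite (ltn_eqF jm) mulr0 /proj_functional big1 ?subr0; first by move/eqP.
  move=> i _; have im : (i < m)%N by rewrite (ltn_trans (ltn_ord i))// ltnW.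
  by rewrite H ?(ltn_eqF im) ?mulr0// ltnS ltnW.
Qed.

End biorthogonal_systems.

(** * Shrinking bases *)

Section functionals_of_a_shrinking_basis.
Context (R : realType).

Lemma continuous_bounded_functional (V : normedModType R) (f : dual V) :
  bounded_functional (dual_fun f).
Proof.
case: f => f cf; rewrite /dual_fun /=; split=> [a u v|]; first by rewrite linearP.
have /linear_boundedP/pinfty_ex_gt0[b _ fb] := continuous_linear_bounded 0 (cf 0).
by exists b.
Qed.

(** Take a linearly independent family of vectors satisfying [P] with the
    largest possible number of members: a vector satisfying [P] outside its span
    would enlarge it. *)
Lemma finite_spanning_matrix (F : fieldType) N (P : 'rV[F]_N -> Prop) :
  exists r (M : 'M[F]_(r, N)), (forall i, P (row i M)) /\
    forall c, P c -> (c <= M)%MS.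
Proof.
pose Q r := exists M : 'M[F]_(r, N), (forall i, P (row i M)) /\ row_free M.
have exQ : exists r, `[< Q r >].
  exists 0%N; apply/asboolP; exists 0; split=> [[]//|].
  by rewrite /row_free mxrank0.
have leQ r : `[< Q r >] -> (r <= N)%N.
  by move=> /asboolP[M [_ /eqP <-]]; exact: rank_leq_col.
case: (ex_maxnP exQ leQ) => r /asboolP[M [PM freeM]] maxr.
exists r, M; split=> // c Pc; apply: contrapT => /negP cM.
suff /maxr : `[< Q (r + 1)%N >] by rewrite addn1 ltnn.
apply/asboolP; exists (col_mx M c); split=> [i|].
  case: (split_ordP i) => j ->; first by rewrite rowKu.
  by rewrite rowKd ord1 row_id.
rewrite /row_free eqn_leq rank_leq_row -addsmxE /= addn1.
rewrite -[X in (X < _)%N](eqP freeM); apply: rank_ltmx.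
by rewrite /ltmx addsmxSl /= addsmx_sub submx_refl /=.
Qed.

Context (Y : normedModType R) (e : nat -> Y).
Hypothesis be : schauder_basis e.

Lemma coordinateP y : expansion e y (coordinate e ^~ y).
Proof.
by have [a [ya _]] := be y; apply: (@getPex _ (expansion e y)); exists a.
Qed.

Lemma coordinate_unique y a : expansion e y a -> a = coordinate e ^~ y.
Proof.
move=> ya; have [b [_ bu]] := be y.
by rewrite -(bu _ ya) (bu _ (coordinateP (y := y))).
Qed.

Lemma coordinate_lin n (a : R) u v :
  coordinate e n (a *: u + v) = a * coordinate e n u + coordinate e n v.
Proof.
suff /coordinate_unique/(congr1 (@^~ n)) <- : expansion e (a *: u + v)
  (fun n => a * coordinate e n u + coordinate e n v) by [].
rewrite /expansion.
have -> : series (fun k => (a * coordinate e k u + coordinate e k v) *: e k) =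
    (fun k => a *: series (fun k => coordinate e k u *: e k) k +
              series (fun k => coordinate e k v *: e k) k).
  apply/funext => k; rewrite /series /= scaler_sumr -big_split /=.
  by apply: eq_bigr => i _; rewrite scalerDl scalerA.
by apply: cvgD; [apply: cvgZr|]; exact: coordinateP.
Qed.

Definition coordinate_comb N (c : 'I_N -> R) y :=
  \sum_(n < N) c n * coordinate e n y.

Lemma coordinate_comb_lin N (c : 'I_N -> R) (a : R) u v :
  coordinate_comb c (a *: u + v) = a * coordinate_comb c u + coordinate_comb c v.
Proof.
rewrite /coordinate_comb mulr_sumr -big_split /=; apply: eq_bigr => i _.
by rewrite coordinate_lin; ring.
Qed.

(** The difference is linear and bounded on the unit ball, hence a bounded
    functional; so is the combination, being the difference of two such. *)
Lemma bounded_coordinate_comb N (c : 'I_N -> R) (f : dual Y) (eps : R) :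
  (dual_norm (fun y => (dual_fun f y - coordinate_comb c y)%R) < eps%:E)%E ->
  bounded_functional (coordinate_comb c) /\
  forall y, `|y| <= 1 -> `|dual_fun f y - coordinate_comb c y| <= eps.
Proof.
move=> feps.
have bf := continuous_bounded_functional f.
have le1 y : `|y| <= 1 -> `|dual_fun f y - coordinate_comb c y| <= eps.
  move=> y1; rewrite -lee_fin; apply: le_trans (ltW feps).
  by apply: ereal_sup_ubound; exists y.
split=> //; split=> [a u v|]; first exact: coordinate_comb_lin.
have [b _ fb] := bfun_bound bf; exists (b + eps) => v.
have comb0 : coordinate_comb c 0 = 0.
  by have := coordinate_comb_lin c 1 0 0; rewrite scale1r addr0; lra.
have [->|v0] := eqVneq v 0; first by rewrite comb0 !normr0 mulr0.
have nv : 0 < `|v| by rewrite normr_gt0.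
have : `|dual_fun f v - coordinate_comb c v| <= eps * `|v|.
  rewrite -ler_pdivrMr//.
  have := le1 (`|v|^-1 *: v); rewrite normrZ normfV normr_id mulVf ?gt_eqF//.
  move=> /(_ (lexx _)); rewrite bfunZ//.
  have := coordinate_comb_lin c `|v|^-1 v 0; rewrite addr0 comb0 addr0 => ->.
  by rewrite -mulrBr normrM normfV normr_id mulrC.
have := fb v; have := ler_normB (dual_fun f v) (dual_fun f v - coordinate_comb c v).
by rewrite opprB addrCA subrr addr0; lra.
Qed.

End functionals_of_a_shrinking_basis.

(** The combinations of coordinates that approximate a bounded functional are
    themselves bounded. For each [N], those involving the first [N] coordinates
    form a finite-dimensional space of functionals, and bases of all these
    spaces together form the countable family [g], whose span is dense in the
    dual. On a bounded sequence, convergence to 0 against a dense set of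
    functionals gives convergence to 0 against all of them. *)
Lemma shrinking_weak_null (R : realType) (Y : normedModType R) (e : nat -> Y) :
  shrinking_basis e ->
  exists2 g : nat -> Y -> R, forall j, bounded_functional (g j) &
    forall y : nat -> Y, (forall n, `|y n| = 1) ->
      (forall j, exists n, forall m, (n <= m)%N -> g j (y m) = 0) ->
      forall f : dual Y, dual_fun f (y n) @[n --> \oo] --> (0 : R).
Proof.
move=> [be she].
pose P N (c : 'rV[R]_N) := bounded_functional (coordinate_comb e (c 0)).
have /choice[r /(_ _)/cid] := fun N => finite_spanning_matrix (@P N).
move=> /all_tag[M PM].
pose g2 N i : Y -> R := if insub i is Some k then coordinate_comb e (M N k) else fun=> 0.
have bg2 N i : bounded_functional (g2 N i).
  rewrite /g2; case: insubP => [k _ _|_]; last exact: bfun_cst0.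
  have := (PM N).1 k; rewrite /P; congr (bounded_functional (coordinate_comb e _)).
  by apply/funext => j; rewrite mxE.
exists (fun j => if unpickle j is Some p then g2 p.1 p.2 else fun=> 0).
  by move=> j; case: unpickle => [p|]; [exact: bg2|exact: bfun_cst0].
move=> y y1 gy f.
have g2y N i : exists n, forall m, (n <= m)%N -> g2 N i (y m) = 0.
  by have [n] := gy (pickle (N, i)); rewrite pickleK; exists n.
apply/cvgrPdist_le => eps eps0.
have [N [c /bounded_coordinate_comb[//|bc feps]]] := she f _ eps0.
have : (\row_n c n <= M N)%MS.
  apply: (PM N).2; rewrite /P; move: bc.
  by congr (bounded_functional (coordinate_comb e _)); apply/funext => j; rewrite mxE.
move=> /submxP[D cD].
have /choice[n ny] := fun i : 'I_(r N) => g2y N i.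
exists (\max_i n i)%N => // m /= nm.
rewrite sub0r normrN; have := feps (y m); rewrite y1 => /(_ (lexx _)).
suff -> : coordinate_comb e c (y m) = 0 by rewrite subr0.
have cE k : c k = \sum_i D 0 i * M N i k.
  by have /rowP/(_ k) := cD; rewrite !mxE.
rewrite /coordinate_comb; under eq_bigr => k _ do rewrite cE mulr_suml.
rewrite exchange_big /=; apply: big1 => i _.
have := ny i m (leq_trans (leq_bigmax i) nm).
rewrite /g2 valK /coordinate_comb => H.
by under eq_bigr => k _ do rewrite -mulrA; rewrite -mulr_sumr H mulr0.
Qed.

(** * Perturbation of biorthogonal systems *)

Lemma half_geometric_sum (R : realType) N :
  \sum_(n < N) (2^-1 : R) ^+ n.+2 <= 2^-1.
Proof.
suff -> : \sum_(n < N) (2^-1 : R) ^+ n.+2 = 2^-1 - 2^-1 ^+ N.+1.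
  by rewrite gerBl exprn_ge0.
elim: N => [|N IH]; first by rewrite big_ord0 expr1 subrr.
rewrite big_ord_recr /= IH (exprS _ N.+1); set x := _ ^+ N.+1.
by field.
Qed.

Section perturbation.
Context (R : realType) (Y : normedModType R).
Context (y z : nat -> Y) (f : nat -> Y -> R) (b : nat -> R).
Hypothesis bf : forall n, bounded_functional (f n).
Hypothesis b1 : forall n, 1 <= b n.
Hypothesis fb : forall n v, `|f n v| <= b n * `|v|.
Hypothesis bio : forall n m, f n (y m) = (n == m)%:R.
Hypothesis yz : forall n, `|y n - z n| <= 2^-1 ^+ n.+2 / b n.

Let eps n : R := 2^-1 ^+ n.+2 / b n.

Let b_gt0 n : 0 < b n. Proof. exact: lt_le_trans ltr01 (b1 n). Qed.

Let eps_gt0 n : 0 < eps n.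
Proof. by rewrite divr_gt0 ?exprn_gt0 ?invr_gt0. Qed.

Let beps n : b n * eps n = 2^-1 ^+ n.+2.
Proof. by rewrite /eps mulrC divfK// gt_eqF. Qed.

Let pow_le4 n : (2^-1 : R) ^+ n.+2 <= 4^-1.
Proof.
rewrite !exprS mulrA (_ : 2^-1 * 2^-1 = 4^-1 :> R); last by field.
by rewrite ler_piMr ?invr_ge0// exprn_ile1//; lra.
Qed.

Let eps_le1 n : eps n <= 1.
Proof.
rewrite ler_pdivrMr// mul1r (le_trans (pow_le4 n))// (le_trans _ (b1 n))//; lra.
Qed.

(** If [z n = z m], then for [i] among [n] and [m] biorthogonality gives
    [1 <= b i * (eps n + eps m)], and multiplying by [eps i] gives
    [eps i <= (eps n + eps m) / 4]; the sum of the two is impossible. *)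
Lemma perturbed_injective : injective z.
Proof.
move=> n m znm; apply/eqP; apply: contrapT => /negP nm.
have dist : `|y n - y m| <= eps n + eps m.
  have -> : y n - y m = (y n - z n) - (y m - z m).
    by rewrite znm opprB addrA subrK.
  by rewrite (le_trans (ler_normB _ _))// lerD.
have key i : `|f i (y n - y m)| = 1 -> eps i <= 4^-1 * (eps n + eps m).
  move=> fi; have : 1 <= b i * (eps n + eps m).
    rewrite -fi (le_trans (fb i _))// ler_wpM2l// ltW//.
  rewrite -(ler_pM2l (eps_gt0 i)) mulr1 mulrA [eps i * b i]mulrC beps => /le_trans.
  by apply; rewrite ler_wpM2r// addr_ge0// ltW.
have en : eps n <= 4^-1 * (eps n + eps m).
  by apply: key; rewrite bfunB// !bio eqxx (negbTE nm) subr0 normr1.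
have em : eps m <= 4^-1 * (eps n + eps m).
  by apply: key; rewrite bfunB// !bio eqxx eq_sym (negbTE nm) sub0r normrN1.
by have := eps_gt0 n; have := eps_gt0 m; lra.
Qed.

(** Applying [f n] to a vanishing series bounds [`|a n|] by [b n * S], where
    [S] is the sum of the [`|a m| * eps m]. Since [b m * eps m] sums to at most
    one half, [S <= S / 2]. *)
Lemma perturbed_independent (a : l1 R) :
  series (fun n => a n *: z n) @ \oo --> (0 : Y) -> a = 0.
Proof.
move=> az0.
pose t m := `|a m| * eps m.
have t0 m : 0 <= t m by rewrite mulr_ge0// ltW.
have ct : cvgn (series t).
  apply: (@series_le_cvg _ _ (fun m => `|a m|)) => // [m|].
    by rewrite ler_piMr.
  exact: l1_cvg.
pose S := limn (series t).
have tS N : \sum_(m < N) t m <= S.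
  rewrite -(big_mkord xpredT).
  by apply: nondecreasing_cvgn_le ct N; apply: nondecreasing_series => n _ _.
have aS n : `|a n| <= b n * S.
  apply/ler_addgt0Pr => d d0.
  have /cvgrPdist_le/(_ (d / b n)) := az0.
  rewrite divr_gt0// => /(_ isT)[N _ /(_ (maxn N n.+1) (leq_maxl _ _))] /=.
  set M := maxn N n.+1; rewrite sub0r normrN => sM.
  have nM : (n < M)%N by exact: leq_maxr.
  have fs : f n (series (fun n => a n *: z n) M) =
      a n - \sum_(m < M) a m * f n (y m - z m).
    rewrite /series /= big_mkord bfun_sum//.
    transitivity (\sum_(m < M) a m * f n (y m) - \sum_(m < M) a m * f n (y m - z m)).
      rewrite -sumrB; apply: eq_bigr => m _.
      by rewrite bfunZ// bfunB//; ring.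
    congr (_ - _); rewrite (bigD1 (Ordinal nM))//= bio eqxx mulr1 big1 ?addr0// => m mn.
    rewrite bio (_ : (n == m) = false) ?mulr0// eq_sym; exact: negbTE mn.
  have sum_le : `|\sum_(m < M) a m * f n (y m - z m)| <= b n * S.
    apply: le_trans (ler_norm_sum _ _ _) _.
    apply: (@le_trans _ _ (b n * \sum_(m < M) t m)); last by rewrite ler_pM2l.
    rewrite mulr_sumr; apply: ler_sum => m _; rewrite normrM /t mulrCA.
    by rewrite ler_wpM2l// (le_trans (fb n _))// ler_wpM2l// ltW.
  have fd : `|f n (series (fun n => a n *: z n) M)| <= d.
    by apply: le_trans (fb n _) _; rewrite mulrC -ler_pdivlMr.
  have -> : a n = f n (series (fun n => a n *: z n) M) +
      \sum_(m < M) a m * f n (y m - z m) by rewrite fs subrK.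
  by rewrite (le_trans (ler_normD _ _))// addrC lerD.
have S0 : 0 <= S by have := tS 0%N; rewrite big_ord0.
have SS : S <= S * 2^-1.
  apply: limr_le => //; near=> N; rewrite /series /= big_mkord.
  apply: (@le_trans _ _ (S * \sum_(m < N) 2^-1 ^+ m.+2)); last first.
    by rewrite ler_wpM2l// half_geometric_sum.
  rewrite mulr_sumr; apply: ler_sum => m _.
  by rewrite -beps mulrA ler_wpM2r ?[S * _]mulrC// ltW.
have S00 : S = 0 by lra.
apply/val_inj/funext => n /=; apply/normr0_eq0/eqP.
by rewrite eq_le normr_ge0 andbT; have := aS n; rewrite S00 mulr0.
Unshelve. all: by end_near. Qed.

(** The error 3/4 splits into 1/4 for replacing the direction of [v] by a nearby
    [zeta j], and 1/2 for replacing each [y i] by [z i] in the expansion of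
    [zeta j], whose coefficients are at most [b i]. *)
Lemma perturbed_approximates (zeta : nat -> Y) :
  unit_sphere Y `<=` closure (range zeta) -> range zeta `<=` unit_sphere Y ->
  (forall j, exists n, zeta j = \sum_(i < n) f i (zeta j) *: y i) ->
  forall v, exists N (c : 'I_N -> R),
    `|v - \sum_(i < N) c i *: z i| <= 3 / 4 * `|v|.
Proof.
move=> zeta_dense zeta1 span v.
have [->|v0] := eqVneq v 0.
  by exists 0%N, (fun=> 0); rewrite big_ord0 subrr !normr0 mulr0.
have nv : 0 < `|v| by rewrite normr_gt0.
have : closure (range zeta) (`|v|^-1 *: v).
  by apply: zeta_dense; rewrite /unit_sphere /= normrZ normfV normr_id mulVf ?gt_eqF.
move=> /(_ (ball (`|v|^-1 *: v) 4^-1)) [|w [[j _ <-]]].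
  by apply: nbhsx_ballx; rewrite invr_gt0.
rewrite -ball_normE /= => vj.
have zj : `|zeta j| = 1 by apply: zeta1; exists j.
have [N zN] := span j.
exists N, (fun i => `|v| * f i (zeta j)).
have zd : `|zeta j - \sum_(i < N) f i (zeta j) *: z i| <= 2^-1.
  rewrite {1}zN -sumrB.
  under eq_bigr do rewrite -scalerBr.
  apply: le_trans (ler_norm_sum _ _ _) _; apply: le_trans (half_geometric_sum R N).
  apply: ler_sum => i _; rewrite normrZ -beps ler_pM//.
  by rewrite (le_trans (fb i _))// zj mulr1.
have -> : v - \sum_(i < N) (`|v| * f i (zeta j)) *: z i =
    `|v| *: ((`|v|^-1 *: v - zeta j) + (zeta j - \sum_(i < N) f i (zeta j) *: z i)).
  rewrite addrA subrK scalerBr scalerA divff ?gt_eqF// scale1r scaler_sumr.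
  by congr (_ - _); apply: eq_bigr => i _; rewrite scalerA.
rewrite normrZ normr_id mulrC ler_wpM2r//.
apply: le_trans (ler_normD _ _) _.
by apply: le_trans (lerD (ltW vj) zd) _; lra.
Qed.

End perturbation.

(** Iterating an approximation with relative error [3 / 4] makes the error
    arbitrarily small. *)
Lemma dense_of_relative_approximation (R : realType) (Y : normedModType R) (Z : set Y) :
  Z 0 -> (forall u v, Z u -> Z v -> Z (u + v)) ->
  (forall v, exists2 z, Z z & `|v - z| <= 3 / 4 * `|v|) ->
  forall v (eps : R), 0 < eps -> exists2 z, Z z & `|v - z| < eps.
Proof.
move=> Z0 ZD ZA v eps eps0.
have approx n : exists2 z, Z z & `|v - z| <= (3 / 4) ^+ n * `|v|.
  elim: n => [|n [z Zz vz]]; first by exists 0 => //; rewrite subr0 expr0 mul1r.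
  have [w Zw vzw] := ZA (v - z); exists (z + w); first exact: ZD.
  rewrite opprD addrA (le_trans vzw)// exprS -[leRHS]mulrA.
  by rewrite ler_wpM2l.
have : (fun n => (3 / 4 : R) ^+ n * `|v|) @ \oo --> (0 * `|v| : R).
  by apply: cvgMl; apply: cvg_expr; rewrite ger0_norm; lra.
rewrite mul0r => /cvgrPdist_lt/(_ _ eps0)[n _ /(_ n (leqnn n))] /=.
rewrite sub0r normrN ger0_norm ?mulr_ge0 ?exprn_ge0// => n_eps.
by have [z Zz vz] := approx n; exists z => //; exact: le_lt_trans n_eps.
Qed.

Lemma dense_of_approximation (R : realType) (Y : normedModType R) (Z : set Y) :
  (forall v (eps : R), 0 < eps -> exists2 z, Z z & `|v - z| < eps) -> dense Z.
Proof.
move=> ZA O [v Ov] oO.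
have /nbhs_ballP[e /= e0 eO] := open_nbhs_nbhs (conj oO Ov).
have [z Zz vz] := ZA v e e0.
by exists z; split=> //; apply: eO; rewrite -ball_normE.
Qed.

(** * The space l1 *)

Section l1_facts.
Context (R : realType).
Implicit Types (x a : l1 R).

Lemma l1_normE x : `|x| = limn [normed series x]. Proof. by []. Qed.

Lemma l1_ext x a : (forall k, x k = a k) -> x = a.
Proof. by move=> xa; apply/val_inj/funext. Qed.

Lemma l1D x a k : (x + a) k = x k + a k. Proof. by []. Qed.

Lemma l1B x a k : (x - a) k = x k - a k. Proof. by []. Qed.

Lemma l1Z (t : R) x k : (t *: x) k = t * x k. Proof. by []. Qed.

Lemma l1_sumE n (F : 'I_n -> l1 R) k : (\sum_(i < n) F i) k = \sum_(i < n) F i k.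
Proof.
elim: n F => [|n IH] F; first by rewrite !big_ord0.
by rewrite !big_ord_recr/= -IH.
Qed.

Lemma l1_partial_sum_le x N : \sum_(0 <= i < N) `|x i| <= `|x|.
Proof.
rewrite l1_normE; apply: (nondecreasing_cvgn_le _ (l1_cvg (x := x)) N).
by apply: nondecreasing_series => n _ _ /=.
Qed.

Lemma l1_sum_le x (s : seq nat) : uniq s -> \sum_(i <- s) `|x i| <= `|x|.
Proof.
move=> us.
have [N sN] : exists N, {subset s <= index_iota 0 N}.
  exists (\max_(i <- s) i).+1 => i si.
  by rewrite mem_index_iota ltnS /=; exact: leq_bigmax_seq.
apply: le_trans (l1_partial_sum_le x N).
rewrite [leRHS](bigID (mem s)) /= -[X in _ <= X + _]big_filter.
rewrite (perm_big [seq i <- index_iota 0 N | i \in s]).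
  by rewrite lerDl sumr_ge0.
apply: uniq_perm => //; first by rewrite filter_uniq ?iota_uniq.
move=> i; rewrite mem_filter; apply/idP/andP => [si|[]//].
by split=> //; exact: sN.
Qed.

Lemma l1_coord_le x k : `|x k| <= `|x|.
Proof. by have := l1_sum_le x (s := [:: k]) isT; rewrite big_seq1. Qed.

Lemma l1_norm_le x (c : R) :
  (forall N, \sum_(0 <= i < N) `|x i| <= c) -> `|x| <= c.
Proof.
by move=> xc; rewrite l1_normE; apply: limr_le; [exact: l1_cvg|near=> N; exact: xc].
Unshelve. all: by end_near. Qed.

Lemma l1_of_bounded (u : nat -> R) (c : R) :
  (forall N, \sum_(0 <= i < N) `|u i| <= c) -> exists x, l1_val x = u.
Proof.
move=> uc.
have ul1 : u \in @l1_pred R.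
  rewrite inE /=; apply: nondecreasing_is_cvgn.
    by apply: nondecreasing_series => n _ _ /=.
  by exists c => _ [N _ <-]; exact: uc.
by exists (L1 ul1).
Qed.

Lemma sum_delta_le1 k N : \sum_(0 <= i < N) `|(i == k)%:R : R| <= 1.
Proof.
rewrite big_mkord; have [kN|kN] := ltnP k N; last first.
  rewrite big1 ?ler01// => i _; rewrite (_ : (i == k :> nat) = false) ?normr0//.
  by rewrite ltn_eqF// (leq_trans (ltn_ord i)).
rewrite (bigD1 (Ordinal kN))//= eqxx normr1 big1 ?addr0// => i ik.
by rewrite (_ : (i == k :> nat) = false) ?normr0//; exact: negbTE ik.
Qed.

Lemma l1_delta_exists k : exists x, l1_val x = (fun i => (i == k)%:R).
Proof. by apply: l1_of_bounded => N; exact: sum_delta_le1. Qed.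

Definition l1_delta k : l1 R := sval (cid (l1_delta_exists k)).

Lemma l1_deltaE k i : l1_delta k i = (i == k)%:R.
Proof. by rewrite /l1_delta; case: cid => x /= ->. Qed.

Lemma l1_norm_delta k : `|l1_delta k| <= 1.
Proof.
apply: l1_norm_le => N; under eq_bigr do rewrite l1_deltaE.
exact: sum_delta_le1.
Qed.

Lemma l1_delta_series x : series (fun k => x k *: l1_delta k) @ \oo --> x.
Proof.
apply/cvgrPdist_le => eps eps0.
have /cvgrPdist_le/(_ _ eps0)[N _ xN] := l1_cvg (x := x).
exists N => // M /xN {xN} /= xM.
have sumE i : (series (fun k => x k *: l1_delta k) M) i = if (i < M)%N then x i else 0.
  rewrite /series /= big_mkord l1_sumE.
  under eq_bigr do rewrite l1Z l1_deltaE.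
  case: ltnP => iM.
    rewrite (bigD1 (Ordinal iM))//= eqxx mulr1 big1 ?addr0// => j ji.
    by rewrite eq_sym (_ : (j == i :> nat) = false) ?mulr0//; exact: negbTE ji.
  rewrite big1// => j _.
  by rewrite gtn_eqF ?mulr0// (leq_trans (ltn_ord j)).
apply: le_trans xM; rewrite -l1_normE [leRHS]ger0_norm; last first.
  by rewrite subr_ge0; exact: l1_partial_sum_le.
apply: l1_norm_le => K.
rewrite lerBrDr.
apply: (@le_trans _ _ (\sum_(0 <= i < maxn K M) `|x i|)); last first.
  exact: l1_partial_sum_le.
have split_sum (u : nat -> R) n m : (n <= m)%N ->
    \sum_(0 <= i < m) u i = \sum_(0 <= i < n) u i + \sum_(n <= i < m) u i.
  by move=> nm; exact: big_cat_nat.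
(* The truncated part of the norm and the norm of the remainder add up to the
   norm, as is seen on partial sums. *)
pose d i := `|(x - series (fun k => x k *: l1_delta k) M) i|.
rewrite (split_sum (fun i => `|x i|) M (maxn K M)) ?leq_maxr// addrC lerD2l.
apply: (@le_trans _ _ (\sum_(0 <= i < maxn K M) d i)).
  by rewrite (split_sum d K (maxn K M)) ?leq_maxl// lerDl sumr_ge0// => i _; exact: normr_ge0.
rewrite (split_sum d M (maxn K M)) ?leq_maxr// big_nat big1 ?add0r.
  rewrite big_nat [leRHS]big_nat; apply: ler_sum => i /andP[Mi _].
  by rewrite /d l1B sumE ltnNge Mi /= subr0.
by move=> i /andP[_ iM]; rewrite /d l1B sumE iM subrr normr0.
Qed.

Lemma linear_function (V W : lmodType R) (f : V -> W) :
  (forall (t : R) u v, f (t *: u + v) = t *: f u + f v) ->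
  exists F : {linear V -> W}, F =1 f.
Proof.
move=> fL; pose M := @GRing.isLinear.Build R V W *:%R f fL.
by pose F : {linear V -> W} := HB.pack f M; exists F.
Qed.

(** The sequences supported on the range of an injection form a copy of l1:
    [J] moves the coordinate [n] to the place [k n], and [P] reads it back. *)
Lemma l1_reindex (k : nat -> nat) : injective k ->
  exists (J P : {linear l1 R -> l1 R}),
    [/\ forall a n, J a (k n) = a n,
        forall a m, (forall n, k n != m) -> J a m = 0,
        forall x n, P x n = x (k n),
        forall a, `|J a| <= `|a| & forall x, `|P x| <= `|x|].
Proof.
move=> kinj.
have /choice[h hE] m : exists o : option nat,
    if o is Some n then k n = m else forall n, k n != m.
  have [[n <-]|km] := pselect (exists n, k n = m); first by exists (Some n).
  by exists None => n; apply/eqP => kn; apply: km; exists n.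
have hk n : h (k n) = Some n.
  by have := hE (k n); case: (h (k n)) => [i /kinj ->//|/(_ n)]; rewrite eqxx.
pose j a m := oapp a 0 (h m).
have j_le a N : \sum_(0 <= m < N) `|j a m| <= `|a|.
  have -> : \sum_(0 <= m < N) `|j a m| = \sum_(n <- pmap h (index_iota 0 N)) `|a n|.
    rewrite big_pmap; apply: eq_bigr => m _; rewrite /j.
    by case: (h m) => //=; rewrite normr0.
  apply: l1_sum_le; apply: (@pmap_uniq _ _ h k); last exact: iota_uniq.
  by move=> m; have := hE m; case: (h m).
have /choice[J JE] a : exists x, l1_val x = j a by exact: l1_of_bounded (j_le a).
have p_le x N : \sum_(0 <= n < N) `|x (k n)| <= `|x|.
  rewrite -(big_map k xpredT (fun i => `|x i|)); apply: l1_sum_le.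
  by rewrite map_inj_uniq// iota_uniq.
have /choice[P PE] x : exists a, l1_val a = (fun n => x (k n)).
  exact: l1_of_bounded (p_le x).
have [|J' J'E] := @linear_function _ _ J.
  move=> t u v; apply: l1_ext => m.
  rewrite l1D l1Z !JE /j; case: (h m) => [n|] //.
  by rewrite [RHS]addr0 mulr0.
have [|P' P'E] := @linear_function _ _ P.
  move=> t u v; apply: l1_ext => m.
  by rewrite l1D l1Z !PE.
exists J', P'; split.
- by move=> a n; rewrite J'E JE /j hk.
- move=> a m km; rewrite J'E JE /j; have := hE m; case: (h m) => //= n.
  by move/eqP; rewrite (negbTE (km n)).
- by move=> x n; rewrite P'E PE.
- move=> a; apply: l1_norm_le => N; under eq_bigr do rewrite J'E JE.
  exact: j_le.
- move=> x; apply: l1_norm_le => N; under eq_bigr do rewrite P'E PE.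
  exact: p_le.
Qed.

(** Completeness of l1 for geometrically dominated series. The partial sums
    converge coordinatewise, and their Cauchy estimate, read on finitely many
    coordinates, passes to the limit. *)
Lemma l1_geometric_series (w : nat -> l1 R) (c : R) :
  (forall i, `|w i| <= c * 2^-1 ^+ i) ->
  exists x, forall n, `|x - \sum_(i < n) w i| <= 2 * c * 2^-1 ^+ n.
Proof.
move=> wc.
pose s n : l1 R := \sum_(i < n) w i.
have c0 : 0 <= c by have := wc 0%N; rewrite expr0 mulr1; exact: le_trans.
have sB m n : (n <= m)%N -> `|s m - s n| <= 2 * c * 2^-1 ^+ n.
  move=> nm; suff : `|s m - s n| <= 2 * c * (2^-1 ^+ n - 2^-1 ^+ m).
    move/le_trans; apply; rewrite ler_wpM2l ?mulr_ge0// gerBl exprn_ge0//.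
  elim: m nm => [|m IH]; first by rewrite leqn0 => /eqP ->; rewrite !subrr normr0 mulr0.
  rewrite leq_eqVlt => /predU1P[->|]; first by rewrite !subrr normr0 mulr0.
  rewrite ltnS => /IH {}IH; rewrite {1}/s big_ord_recr /= addrAC.
  rewrite (le_trans (ler_normD _ _))//.
  by rewrite exprS; have := wc m; move: IH; rewrite -/(s m); lra.
have sk n k : s n k = series (fun i => w i k) n.
  by rewrite /s l1_sumE /series /= big_mkord.
have cs k : cvgn (fun n => s n k).
  have -> : (fun n => s n k) = series (fun i => w i k) by apply/funext => n.
  apply: normed_cvg; apply: (@series_le_cvg _ _ (geometric c 2^-1)).
  - by move=> n /=.
  - by move=> n; rewrite /= mulr_ge0// exprn_ge0.
  - by move=> n /=; exact: le_trans (l1_coord_le _ _) (wc n).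
  by apply: is_cvg_geometric_series; rewrite ger0_norm; lra.
pose u k := limn (fun n => s n k).
have us n N : \sum_(0 <= k < N) `|u k - s n k| <= 2 * c * 2^-1 ^+ n.
  have : (fun m => \sum_(0 <= k < N) `|s m k - s n k|) @ \oo -->
      \sum_(0 <= k < N) `|u k - s n k|.
    apply: cvg_big => [|k _]; first exact: add_continuous.
    by apply: cvg_norm; apply: cvgB; [exact: cs|exact: cvg_cst].
  move=> lim_s; rewrite -(cvg_lim _ lim_s)//; apply: limr_le.
    by apply/cvg_ex; exists (\sum_(0 <= k < N) `|u k - s n k|).
  near=> m; apply: le_trans (sB m n _); last by near: m; exact: nbhs_infty_ge.
  exact: (l1_partial_sum_le (s m - s n)).
have [N|x xE] := @l1_of_bounded u (2 * c).
  have := us 0%N N; rewrite expr0 mulr1; apply: le_trans.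
  by rewrite le_eqVlt; apply/orP; left; apply/eqP; apply: eq_bigr => k _;
    rewrite /s big_ord0 subr0.
exists x => n; apply: l1_norm_le => N; under eq_bigr do rewrite l1B xE.
exact: us.
Unshelve. all: by end_near. Qed.

End l1_facts.

(** * Complemented copies, lifting and weak continuity *)

Lemma lipschitz_linear_continuous (R : realType) (V W : normedModType R)
    (T : {linear V -> W}) : (forall x, `|T x| <= `|x|) -> continuous T.
Proof.
move=> T1 x; apply/cvgrPdist_le => e e0.
have : \forall y \near x, `|x - y| <= e by exact: cvgr_dist_le.
by apply: filterS => y; rewrite -linearB; exact: le_trans.
Qed.

(** The range of [J] is closed as the null space of [J \o P - id], and the null
    space of [P] is a closed complement of it. *)
Lemma retract_complemented (R : realType) (V W : normedModType R)
    (J : {linear W -> V}) (P : {linear V -> W}) :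
  continuous J -> continuous P -> cancel J P ->
  [/\ closed_subspace (range J), complemented (range J) & isomorphic W (range J)].
Proof.
move=> cJ cP JK.
have closed_eq0 (V1 W1 : normedModType R) (T : V1 -> W1) :
    continuous T -> closed (T @^-1` [set 0]).
  move=> cT; apply: closed_comp => [x _|]; first exact: cT.
  exact/accessible_closed_set1/hausdorff_accessible/norm_hausdorff.
have cU : closed_subspace (range J).
  split; last first.
    rewrite (_ : range J = (fun x => J (P x) - x) @^-1` [set 0]).
      apply: closed_eq0 => x; apply: cvgB; last exact: cvg_id.
      by apply: continuous_comp; [exact: cP|exact: cJ].
    apply/seteqP; split=> [_ [a _ <-] /=|x /= /subr0_eq xE].
      by rewrite JK subrr.
    by exists (P x).
  split; first by rewrite inE; exists 0; rewrite ?linear0.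
  move=> a u v; rewrite !inE => -[u' _ <-] [v' _ <-].
  by exists (a *: u' + v') => //; rewrite linearP.
split=> //; last first.
  exists J, P; split=> //.
  exact: continuous_subspaceT.
exists (P @^-1` [set 0]); split.
- split; last exact: closed_eq0.
  split; first by rewrite inE /= linear0.
  by move=> a u v; rewrite !inE /= linearP => -> ->; rewrite scaler0 addr0.
- apply/seteqP; split=> [_ [[a _ <-]] /= | _ ->].
    by rewrite JK => ->; rewrite linear0.
  by split; [exists 0; rewrite ?linear0|rewrite /= linear0].
- apply/seteqP; split=> // x _; exists (J (P x)); first by exists (P x).
  by exists (x - J (P x)); [rewrite /= linearB /= JK subrr|rewrite addrC subrK].
Qed.

(** Both topologies are initial for a family of scalar functions, so only
    the compositions with those functions matter. *)
Lemma weak_star_to_weak_continuousT (R : realType) (Y : normedModType R)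
    (A : l1 R -> Y) :
  (forall f : dual Y, exists c : c0 R, forall x, dual_fun f (A x) = c0_pairing x c) ->
  continuous (A : weak_star_topology R -> weak_topology Y).
Proof.
move=> Ac.
apply: (@continuous_comp_initial Y (weak_star_topology R) {ptws dual Y -> R}).
move=> x; apply/cvg_sup; first exact/fmap_filter/(nbhs_filter (x : weak_star_topology R)).
move=> f; move: x.
apply: (@continuous_comp_initial _ (weak_star_topology R) R^o (@^~ f)).
have [c Acf] := Ac f.
have ev_c (h : {ptws c0 R -> R}) : (fun h : {ptws c0 R -> R} => h c) @ h --> h c.
  have /cvg_sup/(_ c) hc : h --> h by exact: cvg_id.
  exact: cvg_comp hc (@initial_continuous {ptws c0 R -> R} R^o (@^~ c) h).
have -> : @^~ f \o ((fun v => (fun g : dual Y => dual_fun g v)) \o A) =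
    (fun h : {ptws c0 R -> R} => h c) \o (@c0_pairing R).
  by apply/funext => x; exact: Acf.
move=> x.
have pairing_c := @initial_continuous (l1 R) {ptws c0 R -> R} (@c0_pairing R) x.
by apply: cvg_comp; [exact: pairing_c|exact: ev_c].
Qed.

Section mazur_operator.
Context (R : realType) (Y : completeNormedModType R) (B : {linear l1 R -> Y}).
Context (zeta : nat -> Y).
Hypothesis zeta1 : range zeta `<=` unit_sphere Y.
Hypothesis zeta_dense : unit_sphere Y `<=` closure (range zeta).
Hypothesis BE : forall x : l1 R, series (fun k => x k *: zeta k) @ \oo --> B x.

Lemma norm_zeta k : `|zeta k| = 1.
Proof. by apply: zeta1; exists k. Qed.

Lemma mazur_contraction x : `|B x| <= `|x|.
Proof.
have /cvg_norm Bx := @BE x.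
rewrite -(cvg_lim _ Bx)//; apply: limr_le.
  by apply/cvg_ex; exists `|B x|.
near=> N; apply: le_trans (l1_partial_sum_le x N).
apply: le_trans (ler_norm_sum _ _ _) _.
by apply: ler_sum => k _; rewrite normrZ norm_zeta mulr1.
Unshelve. all: by end_near. Qed.

Lemma mazur_continuous : continuous B.
Proof. exact: lipschitz_linear_continuous mazur_contraction. Qed.

Lemma mazur_delta k : B (l1_delta R k) = zeta k.
Proof.
have Bk := @BE (l1_delta R k); rewrite -(cvg_lim _ Bk)//.
apply: cvg_lim => //; apply: cvg_near_cst.
exists k.+1 => // n /= kn.
rewrite /series /= big_mkord (bigD1 (Ordinal kn))//= l1_deltaE eqxx scale1r.
rewrite big1 ?addr0// => i ik; rewrite l1_deltaE.
by rewrite (_ : (i == k :> nat) = false) ?scale0r//; exact: negbTE ik.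
Qed.

(** Greedy expansion: the residue [r] of a vector is replaced by
    [r - `|r| *: zeta m] with [zeta m] close to its direction, which halves it.
    The coefficients are summable, so the expansion is an element of l1. *)
Lemma mazur_lift v : exists2 x : l1 R, B x = v & `|x| <= 2 * `|v|.
Proof.
have /choice[m mE] r : exists m, `|r - `|r| *: zeta m| <= 2^-1 * `|r|.
  have [->|r0] := eqVneq r 0.
    by exists 0%N; rewrite normr0 scale0r subrr normr0 mulr0.
  have nr : 0 < `|r| by rewrite normr_gt0.
  have : closure (range zeta) (`|r|^-1 *: r).
    by apply: zeta_dense; rewrite /unit_sphere /= normrZ normfV normr_id mulVf ?gt_eqF.
  move=> /(_ (ball (`|r|^-1 *: r) 2^-1)) [|w [[j _ <-]]].
    by apply: nbhsx_ballx; rewrite invr_gt0.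
  rewrite -ball_normE /= => rj; exists j.
  have -> : r - `|r| *: zeta j = `|r| *: (`|r|^-1 *: r - zeta j).
    by rewrite scalerBr scalerA divff ?gt_eqF// scale1r.
  by rewrite normrZ normr_id mulrC ler_wpM2r// ltW.
pose r := fix r n := if n is n'.+1 then r n' - `|r n'| *: zeta (m (r n')) else v.
have r_le n : `|r n| <= `|v| * 2^-1 ^+ n.
  elim: n => [|n IH]; first by rewrite expr0 mulr1.
  by rewrite /= (le_trans (mE _))// exprS mulrCA ler_wpM2l.
pose w n : l1 R := `|r n| *: l1_delta R (m (r n)).
have w_le n : `|w n| <= `|v| * 2^-1 ^+ n.
  rewrite normrZ normr_id (le_trans _ (r_le n))//.
  by rewrite ler_piMr// l1_norm_delta.
have Bw n : B (\sum_(i < n) w i) = v - r n.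
  elim: n => [|n IH]; first by rewrite big_ord0 linear0 subrr.
  rewrite big_ord_recr linearD IH /= linearZ /= mazur_delta.
  by rewrite opprB addrA addrAC.
have [x xw] := l1_geometric_series w_le.
exists x; last by have := xw 0%N; rewrite big_ord0 subr0 expr0 mulr1.
apply/eqP; rewrite -subr_eq0 -normr_le0; apply/ler_addgt0Pr => e e0; rewrite add0r.
have : (fun n => 3 * `|v| * (2^-1 : R) ^+ n) @ \oo --> (3 * `|v| * 0 : R).
  by apply: cvgMr; apply: cvg_expr; rewrite ger0_norm; lra.
rewrite mulr0 => /cvgrPdist_le/(_ _ e0)[n _ /(_ n (leqnn n))] /=.
rewrite sub0r normrN ger0_norm ?mulr_ge0 ?exprn_ge0// => n_e.
have -> : B x - v = B (x - \sum_(i < n) w i) - r n.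
  by rewrite linearB Bw opprB addrA addrAC addrK.
apply: le_trans n_e; apply: le_trans (ler_normB _ _) _.
have := le_trans (mazur_contraction _) (xw n); have := r_le n; lra.
Qed.

End mazur_operator.

(** * The quasi-complement *)

Lemma delta_series_image (R : realType) (V : normedModType R)
    (T : {linear l1 R -> V}) (a : l1 R) : continuous T ->
  series (fun n => a n *: T (l1_delta R n)) @ \oo --> T a.
Proof.
move=> cT.
have -> : series (fun n => a n *: T (l1_delta R n)) =
    T \o series (fun n => a n *: l1_delta R n).
  apply/funext => N; rewrite /series /= linear_sum.
  by apply: eq_bigr => i _; rewrite linearZ.
by apply: continuous_cvg; [exact: cT|exact: l1_delta_series].
Qed.

Theorem proposition12 (R : realType) (Y : completeNormedModType R)
    (Ysep : separable Y) (Yinf : infinite_dimensional Y)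
    (B : {linear l1 R -> Y}) (Bmazur : mazur_type B)
    (Bonto : range B = [set: Y]) :
  exists U : set (l1 R),
    [/\ closed_subspace U,
        complemented U,
        isomorphic (l1 R) U &
        [/\ {in U &, injective B},
            dense (B @` U),
            quasi_complement (null_space B) U &
            (exists e : nat -> Y, shrinking_basis e) ->
            weak_star_to_weak_continuous U B]].
Proof.
have [_ [zeta [zeta1 zeta_dense BE]]] := Bmazur.
have [g bg g_weak] : exists2 g : nat -> Y -> R, forall j, bounded_functional (g j) &
    (exists e : nat -> Y, shrinking_basis e) ->
    forall y : nat -> Y, (forall n, `|y n| = 1) ->
      (forall j, exists n, forall m, (n <= m)%N -> g j (y m) = 0) ->
      forall f : dual Y, dual_fun f (y n) @[n --> \oo] --> (0 : R).
  have [[e she]|nsh] := pselect (exists e : nat -> Y, shrinking_basis e).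
    by have [g bg gP] := shrinking_weak_null she; exists g.
  by exists (fun _ => fun=> 0) => // j; exact: bfun_cst0.
(* Requiring the [g j] to vanish eventually on [y] makes [y] weakly null when a
   shrinking basis exists; in the other case they are 0. *)
have [y [f [y1 bf bio span gy]]] := biorthogonal_sequence Yinf zeta bg.
have /choice[b bP] n : exists b, 1 <= b /\ forall v, `|f n v| <= b * `|v|.
  by have [b b1 fb] := bfun_bound (bf n); exists b.
have b1 n : 1 <= b n := (bP n).1.
have fb n v : `|f n v| <= b n * `|v| := (bP n).2 v.
have /choice[k yz] n : exists k, `|y n - zeta k| <= 2^-1 ^+ n.+2 / b n.
  have e0 : 0 < 2^-1 ^+ n.+2 / b n.
    by rewrite divr_gt0 ?exprn_gt0 ?invr_gt0// (lt_le_trans ltr01).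
  have /zeta_dense /(_ _ (nbhsx_ballx (y n) _ e0)) [_ [[i _ <-]]] : unit_sphere Y (y n).
    exact: y1.
  by rewrite -ball_normE /= => yi; exists i; exact: ltW.
pose z n := zeta (k n).
have kinj : injective k.
  move=> n m knm; apply: (perturbed_injective bf b1 fb bio (z := z) yz).
  by rewrite /z knm.
have [J [P [JE J0 PE J1 P1]]] := l1_reindex R kinj.
have JK : cancel J P by move=> a; apply: l1_ext => n; rewrite PE JE.
have cJ : continuous J by exact: lipschitz_linear_continuous.
have cP : continuous P by exact: lipschitz_linear_continuous.
have cB : continuous B by exact: mazur_continuous BE.
have Jdelta n : J (l1_delta R n) = l1_delta R (k n).
  apply: l1_ext => m; rewrite l1_deltaE.
  have [[i <-]|km] := pselect (exists i, k i = m).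
    by rewrite JE l1_deltaE (inj_eq kinj).
  have km' i : k i != m by apply/eqP => ki; apply: km; exists i.
  by rewrite J0// eq_sym (negbTE (km' n)).
have BJdelta n : B (J (l1_delta R n)) = z n by rewrite Jdelta (mazur_delta BE).
have BJ_series (a : l1 R) : series (fun n => a n *: z n) @ \oo --> B (J a).
  have cBJ : continuous (B \o J).
    by move=> x; apply: continuous_comp; [exact: cJ|exact: cB].
  have := @delta_series_image _ _ (B \o J) a cBJ.
  by under [fun n => _ *: _]eq_fun do rewrite /= BJdelta.
have BJ0 a : B (J a) = 0 -> a = 0.
  move=> Ba; apply: (perturbed_independent bf b1 fb bio (z := z) yz).
  by rewrite -Ba; exact: BJ_series.
have [cU coU isoU] := retract_complemented cJ cP JK.
have BUapprox v (e : R) : 0 < e -> exists2 w, (B @` range J) w & `|v - w| < e.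
  apply: dense_of_relative_approximation v e.
  - by exists 0; [exists 0 => //|]; rewrite linear0.
  - move=> _ _ [_ [a _ <-] <-] [_ [a' _ <-] <-].
    by exists (J (a + a')); [exists (a + a')|rewrite !linearD].
  - move=> v; have [N [c vc]] :=
      perturbed_approximates b1 fb (z := z) yz zeta_dense zeta1 span v.
    exists (\sum_(i < N) c i *: z i) => //.
    exists (J (\sum_(i < N) c i *: l1_delta R i)); first by eexists.
    by rewrite !linear_sum; apply: eq_bigr => i _; rewrite !linearZ /= BJdelta.
exists (range J); split=> //; split.
- move=> u v; rewrite !inE => -[a _ <-] [a' _ <-] Baa'.
  suff : a - a' = 0 by move/subr0_eq ->.
  by apply: BJ0; rewrite !linearB /= Baa' subrr.
- exact: dense_of_approximation BUapprox.
- split=> //.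
    apply/seteqP; split=> [_ [[a _ <-] /BJ0 ->] | _ ->]; first by rewrite /= linear0.
    by split; [exists 0; rewrite ?linear0|rewrite /null_space /= linear0].
  (* Approximate [B x] by [B u] with [u] in the subspace and lift the difference
     to a short vector [w]; then [x - u - w] is in the null space. *)
  apply: dense_of_approximation => x e e0.
  have [_ [u Uu <-] xu] : exists2 w, (B @` range J) w & `|B x - w| < e / 2.
    by apply: BUapprox; rewrite divr_gt0.
  have [w Bw w_le] := mazur_lift zeta1 zeta_dense BE (B x - B u).
  exists (u + (x - u - w)).
    exists u => //; exists (x - u - w) => //.
    by rewrite /null_space /= !linearB /= Bw subrr.
  have -> : x - (u + (x - u - w)) = w.
    by rewrite [u + _]addrA [u + _]addrCA subrr addr0 opprB addrC subrK.
  by apply: le_lt_trans w_le _; lra.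
move=> sh.
have z_weak (h : dual Y) : dual_fun h (z n) @[n --> \oo] --> (0 : R).
  have bh := continuous_bounded_functional h.
  have [c c1 hc] := bfun_bound bh.
  have c0 : 0 < c by exact: lt_le_trans ltr01 c1.
  have small : (fun n => c * (2^-1 : R) ^+ n) @ \oo --> (c * 0 : R).
    by apply: cvgMr; apply: cvg_expr; rewrite ger0_norm; lra.
  apply/cvgrPdist_le => e e0.
  have e20 : 0 < e / 2 by rewrite divr_gt0.
  have /cvgrPdist_le/(_ _ e20)[N1 _ yN] := g_weak sh y y1 gy h.
  have /cvgrPdist_le/(_ _ e20)[N2 _ cN] := small.
  exists (maxn N1 N2) => // n /=; rewrite geq_max => /andP[n1 n2].
  have := yN n n1; have := cN n n2; rewrite /= mulr0 !sub0r !normrN.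
  rewrite ger0_norm ?mulr_ge0 ?exprn_ge0 ?(ltW c0)// => cn hy.
  have -> : dual_fun h (z n) = dual_fun h (y n) - dual_fun h (y n - z n).
    by rewrite (bfunB _ _ bh) opprB addrC subrK.
  rewrite (le_trans (ler_normB _ _))// [leRHS](_ : e = e / 2 + e / 2); last by field.
  rewrite lerD// (le_trans (hc _))// (le_trans _ cn)// ler_pM2l//.
  rewrite (le_trans (yz n))// ler_pdivrMr ?(lt_le_trans ltr01)//.
  apply: (@le_trans _ _ (2^-1 ^+ n)); last by rewrite ler_peMr ?exprn_ge0.
  by rewrite !exprS mulrA ler_piMl ?exprn_ge0//; lra.
(* On the range of [J] the operator agrees with [B \o J \o P], which is
   continuous on the whole of l1. *)
have BJP (h : dual Y) : exists c : c0 R, forall x, dual_fun h (B (J (P x))) = c0_pairing x c.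
  have bh := continuous_bounded_functional h.
  pose c m := if pselect (exists n, k n = m) then dual_fun h (zeta m) else 0.
  have c_c0 : c @ \oo --> (0 : R).
    apply/cvgrPdist_le => e e0.
    have /cvgrPdist_le/(_ _ e0)[N _ zN] := z_weak h.
    exists (\max_(n < N) k n).+1 => // m /= km.
    rewrite /c; case: pselect => [[n kn]|mk] /=; last by rewrite subrr normr0 ltW.
    rewrite -kn; apply: zN => /=; rewrite leqNgt; apply/negP => nN.
    move: km; rewrite -kn ltnNge => /negP; apply.
    exact: (leq_bigmax (F := fun n : 'I_N => k n) (Ordinal nN)).
  exists (exist _ c c_c0) => x; rewrite /c0_pairing /=.
  have hB : dual_fun h \o series (fun m => J (P x) m *: zeta m) @ \oo -->
      dual_fun h (B (J (P x))).
    by apply: continuous_cvg; [exact: (svalP h)|exact: BE].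
  rewrite -(cvg_lim _ hB)//; congr (lim (_ @ \oo)); apply/funext => N.
  rewrite /series /= !big_mkord bfun_sum//; apply: eq_bigr => m _.
  rewrite bfunZ// /c; case: pselect => [[n kn]|km] /=; first by rewrite -kn JE PE.
  rewrite J0 ?mul0r ?mulr0// => n.
  by apply/eqP => kn; apply: km; exists n.
have cT := weak_star_to_weak_continuousT (A := fun x => B (J (P x))) BJP.
rewrite /weak_star_to_weak_continuous /continuous_on.
have := @continuous_subspaceT (weak_star_topology R) (weak_topology Y) (range J) _ cT.
apply: subspace_eq_continuous => _ /set_mem[a _ <-].
by rewrite /from_subspace JK.
Qed.
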